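(* Let $\lambda>1$ and $\beta>0$. There exists a non-trivial stationary solution $\{a_n\}_{n\ge1}$ such that (i) $a_n = O(\lambda^{(2-\beta)n})$ as $n\to\infty$, if $\beta<3$; (ii) $a_n = O(n\lambda^{-n})$ as $n\to\infty$, if $\beta=3$; (iii) $a_n = O(\lambda^{-\beta n/3})$ as $n\to\infty$, if $\beta>3$. Moreover, these estimates cannot be improved, in the sense that any non-trivial stationary solution $\{a_n\}_{n\ge 1}$ satisfies (i') $\limsup_{n\to\infty}|a_n|\lambda^{(\beta-2)n}>0$, if $\beta<3$; (ii') $\limsup_{n\to\infty}|a_n|\lambda^{n}=+\infty$, if $\beta=3$; (iii') $\limsup_{n\to\infty}|a_n|\lambda^{\beta n/3}>0$, if $\beta>3$.
   Context: A stationary solution (for parameters $\lambda>1$, $\beta>0$) is a sequence $\{a_n\}_{n\ge1}$ of real numbers satisfying, with the convention $a_0=0$, $$\lambda^{2n}a_n-\lambda^{\beta n}a_{n-1}^2+\lambda^{\beta(n+1)}a_na_{n+1}=0,\qquad n=1,2,\dots.$$ It is non-trivial if $a_n\ne0$ for at least one $n$. *)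

(* Defs.v *)
From mathcomp Require Export all_boot all_order all_algebra.
From mathcomp Require Export all_classical all_reals all_analysis.
Import Order.TTheory GRing.Theory Num.Theory numFieldNormedType.Exports.

Set Implicit Arguments.
Unset Strict Implicit.
Unset Printing Implicit Defensive.

Local Open Scope ring_scope.

(* A sequence indexed by n >= 1 is represented by a : nat -> R, whose value at
   index 0 carries the convention a_0 = 0. *)
Definition stationary_solution (R : realType) (lambda beta : R)
    (a : nat -> R) : Prop :=
  a 0%N = 0 /\
  forall n : nat, (1 <= n)%N ->
    lambda ^+ (2 * n) * a n
    - lambda `^ (beta * n%:R) * a n.-1 ^+ 2
    + lambda `^ (beta * n.+1%:R) * a n * a n.+1 = 0.

Definition nontrivial (R : realType) (a : nat -> R) : Prop :=
  exists n : nat, (1 <= n)%N /\ a n != 0.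

(* Main.v *)
(* Writing a_n = - lambda^((2-beta)n-2) d_n turns the equation into
   d_n d_{n+1} = q d_{n-1}^2 + d_n with q = lambda^(2(beta-3)).  From the term
   after the first nonzero one on, d_n >= 1, and E_n = d_{n+1} d_n^2 satisfies
   E_{n+1} = q E_n + d_{n+1}^2; this gives the lower bounds.
   For existence, start from d_1 = s in [0, 1] and d_2 = 1: every d_n is
   monotone in s, in a direction alternating with n, so nested intervals and
   compactness yield an s for which d is nondecreasing.  Monotonicity then gives
   d_n^3 <= E_n, so that g_n = E_n^(1/3) satisfies g_{n+1} <= p g_n + 1 with
   p = q^(1/3), which is the required growth in all three cases. *)

Require Import Defs.
From mathcomp Require Import ring lra zify.
Import Order.TTheory GRing.Theory Num.Theory numFieldNormedType.Exports.

Set Implicit Arguments.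
Unset Strict Implicit.
Unset Printing Implicit Defensive.

Local Open Scope classical_set_scope.
Local Open Scope ring_scope.

(** * Lower bounds for a limit superior *)

Lemma frequently_le_limn_esup (R : realType) (u : nat -> \bar R) (c : \bar R) :
  (forall N, exists2 n, (N <= n)%N & (c <= u n)%E) -> (c <= limn_esup u)%E.
Proof.
move=> freq; rewrite limn_esup_lim (cvg_lim _ (@cvg_esups_inf _ u))//.
apply: le_ereal_inf_tmp => _ [N _ <-]; have [n Nn cun] := freq N.
by apply: le_ereal_sup_tmp; exists (u n) => //; exists n.
Qed.

(** * The recurrence started at s: sign, continuity and dependence on s *)

(* [profile q s n] is d_{n+1}; the factor d_0 = 0 is left out. *)
Fixpoint profile (R : realType) (q s : R) (n : nat) : R :=
  match n with
  | 0%N => s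
  | m.+1 => match m with
            | 0%N => 1
            | k.+1 => q * profile q s k ^+ 2 / profile q s m + 1
            end
  end.

Lemma profileSS (R : realType) (q s : R) n :
  profile q s n.+2 = q * profile q s n ^+ 2 / profile q s n.+1 + 1.
Proof. by []. Qed.

Lemma profile_ge1 (R : realType) (q s : R) n : 0 <= q -> 1 <= profile q s n.+1.
Proof.
move=> q0; elim: n => // n IHn.
rewrite profileSS lerDr divr_ge0//; first by rewrite mulr_ge0 ?sqr_ge0.
exact: le_trans ler01 IHn.
Qed.

Lemma profile_neq0 (R : realType) (q s : R) n :
  0 <= q -> profile q s n.+1 != 0.
Proof.
by move=> q0; rewrite gt_eqF// (lt_le_trans ltr01)// profile_ge1.
Qed.

Lemma profile_ge0 (R : realType) (q s : R) n :
  0 <= q -> 0 <= s -> 0 <= profile q s n.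
Proof. by case: n => // n q0 _; exact: le_trans ler01 (profile_ge1 s n q0). Qed.

Lemma profile_rec (R : realType) (q s : R) n : 0 <= q ->
  profile q s n.+1 * profile q s n.+2 = q * profile q s n ^+ 2 + profile q s n.+1.
Proof.
by move=> q0; rewrite profileSS; field; exact: profile_neq0.
Qed.

Lemma profile_continuous (R : realType) (q : R) n : 0 <= q ->
  continuous (fun s => profile q s n).
Proof.
move=> q0; suff [] : continuous (fun s => profile q s n) /\
  continuous (fun s => profile q s n.+1) by [].
elim: n => [|n [cn cSn]]; first by split=> s; [exact: cvg_id | exact: cvg_cst].
split=> // s; apply: cvgD; last exact: cvg_cst.
apply: cvgM; first by apply: cvgM; [exact: cvg_cst | apply: cvgM; exact: cn].
apply: cvgV; last exact: cSn.
exact: profile_neq0.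
Qed.

(** [q * x ^+ 2 / x' + 1] goes up with x and down with x'. If two consecutive terms move in opposite
    directions with s, the next one follows the earlier of the two. *)
Lemma profile_alternating (R : realType) (q s t : R) n :
  0 <= q -> 0 <= s -> s <= t ->
  if odd n then profile q t n <= profile q s n
  else profile q s n <= profile q t n.
Proof.
move=> q0 s0 st; have t0 := le_trans s0 st.
pose P k := if odd k then profile q t k <= profile q s k
  else profile q s k <= profile q t k.
suff [] : P n /\ P n.+1 by [].
have rat (x y x' y' : R) : 0 <= x -> x <= y -> 1 <= y' -> y' <= x' ->
    q * x ^+ 2 / x' + 1 <= q * y ^+ 2 / y' + 1.
  move=> x0 xy y'1 yx'.
  have y'0 : 0 < y' by lra.
  have x'0 : 0 < x' by lra.
  rewrite lerD2r ler_pM ?lef_pV2 ?posrE ?mulr_ge0 ?sqr_ge0 ?invr_ge0 ?(ltW x'0)//.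
  by rewrite ler_wpM2l// lerXn2r ?nnegrE// (le_trans x0).
elim: n => [|n [Pn PSn]]; first by rewrite /P /= lexx.
split=> //; move: Pn PSn; rewrite /P !profileSS /= negbK.
by case: (odd n) => /= Pn PSn; apply: rat; rewrite ?profile_ge0 ?profile_ge1.
Qed.

(** * Shooting for a nondecreasing solution *)

(** With y_k for [profile q s k], subtracting consecutive recurrences leaves y_{n+2} (y_{n+3} -
    y_{n+2}) = q (y_{n+1}^2 - y_n^2). *)
Lemma profile_step_after_flat (R : realType) (q s : R) n : 0 <= q -> 0 <= s ->
  profile q s n <= profile q s n.+1 -> profile q s n.+2 = profile q s n.+1 ->
  profile q s n.+2 <= profile q s n.+3.
Proof.
move=> q0 s0 le_n flat; have ge1 := profile_ge1 s n q0.
have := profile_rec s n q0; have := profile_rec s n.+1 q0.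
rewrite flat => rec1 rec0.
rewrite -(@ler_pM2l _ (profile q s n.+1)) ?rec1 ?rec0; last lra.
by rewrite lerD2r ler_wpM2l// lerXn2r ?nnegrE ?profile_ge0.
Qed.

(** Let y be the common value of the flat step and z the next term. Then z = q y + 1, so z^2 = q y z
    + z >= q y^2 + z, and the right side is z times the term after z. *)
Lemma profile_drop_after_flat (R : realType) (q s : R) n : 0 <= q -> 0 <= s ->
  profile q s n.+1 = profile q s n -> profile q s n.+1 <= profile q s n.+2 ->
  profile q s n.+3 <= profile q s n.+2.
Proof.
move=> q0 s0 flat le_n; have ge1 := profile_ge1 s n q0.
have ge1' := profile_ge1 s n.+1 q0.
rewrite -(@ler_pM2l _ (profile q s n.+2)) ?profile_rec//; last lra.
have qy0 : 0 <= q * profile q s n.+1 by rewrite mulr_ge0//; lra.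
have qle : q * profile q s n.+1 * profile q s n.+1 <=
    q * profile q s n.+1 * profile q s n.+2 by rewrite ler_wpM2l.
have eqz : profile q s n.+2 = q * profile q s n.+1 + 1.
  by apply: (mulfI (profile_neq0 s n q0)); rewrite profile_rec// -flat; ring.
have sqz : profile q s n.+2 * profile q s n.+2 =
    q * profile q s n.+1 * profile q s n.+2 + profile q s n.+2.
  by rewrite {1}eqz; ring.
by rewrite sqz lerD2r; lra.
Qed.

Definition increasing_upto (R : realType) (q s : R) (n : nat) : Prop :=
  forall k, (k <= n)%N -> profile q s k <= profile q s k.+1.

Lemma increasing_uptoS (R : realType) (q s : R) n : increasing_upto q s n ->
  profile q s n.+1 <= profile q s n.+2 -> increasing_upto q s n.+1.
Proof. by move=> H leS k; rewrite leq_eqVlt => /predU1P[->|/H]. Qed.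

(** Neighbouring terms move in opposite directions with s, so each increment is monotone in s: for
    odd k its sign at l passes to c, for even k its sign at u does. *)
Lemma increasing_upto_between (R : realType) (q l u c : R) n :
  0 <= q -> 0 <= l -> l <= c -> c <= u ->
  increasing_upto q l n -> increasing_upto q u n -> increasing_upto q c n.
Proof.
move=> q0 l0 lc cu Hl Hu k kn; have c0 := le_trans l0 lc.
have := Hl k kn; have := Hu k kn.
have := profile_alternating k q0 l0 lc; have := profile_alternating k q0 c0 cu.
have := profile_alternating k.+1 q0 l0 lc.
have := profile_alternating k.+1 q0 c0 cu.
rewrite /=; case: (odd k) => /=; lra.
Qed.

(** The sign condition is a product because the shooting meets both orientations: increments going
    from + to - at even steps, from - to + at odd ones. *)
Lemma profile_flat_between (R : realType) (q l u : R) n : 0 <= q -> l <= u ->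
  (profile q l n.+1 - profile q l n) * (profile q u n.+1 - profile q u n) <= 0 ->
  exists2 c, l <= c <= u & profile q c n.+1 = profile q c n.
Proof.
move=> q0 lu sgn; pose f s := profile q s n.+1 - profile q s n.
have cf : continuous f.
  by move=> s; apply: cvgB; exact: profile_continuous.
have [||c] := @IVT _ f l u 0 lu; first exact: continuous_subspaceT.
  rewrite -/(f l) -/(f u) in sgn.
  rewrite ge_min le_max; apply/andP; split.
    by have [//|fl] := leP (f l) 0; rewrite /= leNgt; apply/negP => fu; nra.
  by have [//|fl] := leP 0 (f l); rewrite /= leNgt; apply/negP => fu; nra.
by rewrite in_itv => c_in /subr0_eq fc; exists c.
Qed.

(* Invariant of the shooting argument: the last even constraint is an equality
   at the upper end, the last odd one at the lower end. *)
Lemma nested_shooting (R : realType) (q : R) m : 0 <= q -> exists l u : R,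
  [/\ 0 <= l, l <= u & u <= 1] /\
  [/\ increasing_upto q l m.*2.+1, increasing_upto q u m.*2.+1,
      profile q u m.*2.+1 = profile q u m.*2 &
      profile q l m.*2.+2 = profile q l m.*2.+1].
Proof.
move=> q0; elim: m => [|m [l [u [[l0 lu u1] [Hl Hu fu fl]]]]].
  (* s = 0 gives 0, 1, 1, flat at the second step; s = 1 gives 1, 1, q + 1, flat at the first. *)
  exists 0, 1; do 2?[split=> //].
  - by move=> [|[|//]] _ /=; rewrite ?expr0n/= ?mulr0 ?mul0r ?add0r.
  - by move=> [|[|//]] _ /=; rewrite ?expr1n ?divr1; lra.
  - by rewrite /= expr0n/= mulr0 mul0r add0r.
have u0 := le_trans l0 lu.
rewrite doubleS.
(* This step goes up at l and down at u, hence is flat at some c, the new upper end. *)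
have lup : profile q l m.*2.+2 <= profile q l m.*2.+3.
  by apply: profile_step_after_flat => //; exact: Hl.
have udown : profile q u m.*2.+3 <= profile q u m.*2.+2.
  by apply: profile_drop_after_flat => //; exact: Hu.
have [|c /andP[lc cu] fc] := @profile_flat_between _ q l u m.*2.+2 q0 lu.
  by nra.
have c0 := le_trans l0 lc.
have Hc : increasing_upto q c m.*2.+2.
  apply: increasing_uptoS; last by rewrite fc.
  exact: (increasing_upto_between q0 l0 lc cu).
have Hl' : increasing_upto q l m.*2.+2 by exact: increasing_uptoS.
(* One step later it goes up at c and down at l, hence is flat at some b, the new lower end. *)
have cup : profile q c m.*2.+3 <= profile q c m.*2.+4.
  by apply: profile_step_after_flat => //; exact: Hc.
have ldown : profile q l m.*2.+4 <= profile q l m.*2.+3.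
  exact: profile_drop_after_flat.
have [|b /andP[lb bc] fb] := @profile_flat_between _ q l c m.*2.+3 q0 lc.
  by nra.
have b0 := le_trans l0 lb.
exists b, c; split; first by split=> //; lra.
split=> //; apply: increasing_uptoS => //; last by rewrite fb.
exact: (increasing_upto_between q0 l0 lb bc).
Qed.

Lemma increasing_profile (R : realType) (q : R) : 0 <= q ->
  exists s : R, [/\ 0 <= s, s <= 1 & forall n, profile q s n <= profile q s n.+1].
Proof.
move=> q0.
have /choice[t Ht] : forall n : nat, exists s : R,
    (0 <= s <= 1) /\ increasing_upto q s n.
  move=> n; have [l [u [[l0 lu u1] [Hl _ _ _]]]] := nested_shooting n q0.
  exists l; split; first by rewrite l0 (le_trans lu).
  by move=> k kn; apply: Hl; lia.
have [|s [s01 cls]] := @segment_compact R 0 1 (t n @[n --> \oo]) _.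
  by exists 0%N => // n _; rewrite /= in_itv/=; case: (Ht n).
move: s01; rewrite /= in_itv/= => /andP[s0 s1]; exists s; split=> // n.
rewrite leNgt; apply/negP => drop.
(* A drop at the cluster point s is an open condition, so it would also occur at some [t N] with N
   >= n. *)
pose f x := profile q x n - profile q x n.+1.
have cf : f x @[x --> s] --> f s.
  by apply: cvgB; exact: profile_continuous.
have fpos : \forall x \near s, 0 < f x.
  by apply: (cvgr_gt _ cf); rewrite /f subr_gt0.
have [|_ [[N /= nN <-] fN]] := cls [set t k | k in [set k | (n <= k)%N]] _ _ fpos.
  by exists n => //= k nk; exists k.
by have [_ /(_ n nN)] := Ht N; rewrite -subr_le0 leNgt fN.
Qed.

(** * Growth of a nondecreasing solution *)

(** Induction gives d_{k+1} d_k^2 <= G_k^3; working with cubes avoids cube roots. Indices are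
    shifted as in [profile]. *)
Lemma increasing_growth (R : realType) (p : R) (d : nat -> R) :
  0 <= p -> 0 <= d 0%N -> d 0%N <= 1 -> d 1%N = 1 ->
  (forall n, d n <= d n.+1) ->
  (forall n, d n.+1 * d n.+2 = p ^+ 3 * d n ^+ 2 + d n.+1) ->
  forall n, d n <= iter n (fun x => p * x + 1) 1.
Proof.
move=> p0 d0 d01 d1 dS rec n; set G := fun n => iter n (fun x => p * x + 1) 1.
have dge0 k : 0 <= d k by elim: k => // k IHk; exact: le_trans IHk (dS k).
have Gge0 k : 0 <= G k.
  by elim: k => [|k IHk]; rewrite /G /= ?ler01// addr_ge0// mulr_ge0.
have cube (x y : R) : 0 <= x -> 0 <= y -> x ^+ 3 <= y ^+ 3 -> x <= y.
  by move=> x0 y0; rewrite ler_pXn2r ?nnegrE.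
have E_le k : d k.+1 * d k ^+ 2 <= G k ^+ 3.
  elim: k => [|k IHk]; first by rewrite d1 mul1r expr1n exprn_ile1.
  have -> : d k.+2 * d k.+1 ^+ 2 =
      p ^+ 3 * (d k.+1 * d k ^+ 2) + d k.+1 ^+ 2.
    by rewrite expr2 mulrA (mulrC (d k.+2)) rec; ring.
  have -> : G k.+1 = p * G k + 1 by [].
  set z := p * G k.
  have z0 : 0 <= z by rewrite mulr_ge0.
  have Ez : p ^+ 3 * (d k.+1 * d k ^+ 2) <= z ^+ 3.
    by rewrite /z exprMn ler_wpM2l ?exprn_ge0.
  (* If d_{k+1} <= z + 1, then z^3 + (z + 1)^2 <= (z + 1)^3 suffices. Otherwise monotonicity gives
     d_{k+1}^2 (d_{k+1} - 1) <= z^3, impossible when d_{k+1} - 1 > z. *)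
  have [dz|zd] := leP (d k.+1) (z + 1).
    have : d k.+1 ^+ 2 <= (z + 1) ^+ 2 by rewrite lerXn2r ?nnegrE//; lra.
    nra.
  exfalso.
  have dEz : d k.+1 ^+ 3 <= z ^+ 3 + d k.+1 ^+ 2.
    have : d k.+1 * d k.+1 ^+ 2 <= d k.+2 * d k.+1 ^+ 2.
      by rewrite ler_wpM2r ?sqr_ge0.
    have -> : d k.+2 * d k.+1 ^+ 2 =
      p ^+ 3 * (d k.+1 * d k ^+ 2) + d k.+1 ^+ 2.
      by rewrite expr2 mulrA (mulrC (d k.+2)) rec; ring.
    by rewrite -exprS; lra.
  have : d k.+1 ^+ 2 * z < d k.+1 ^+ 2 * (d k.+1 - 1).
    by rewrite ltr_pM2l ?exprn_gt0//; lra.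
  have : z ^+ 2 * z <= d k.+1 ^+ 2 * z.
    by rewrite ler_wpM2r// lerXn2r ?nnegrE//; lra.
  rewrite mulrBr mulr1 -!exprSr; lra.
apply: (cube _ _ (dge0 _) (Gge0 _)); apply: le_trans (E_le n).
by rewrite exprS ler_wpM2r ?sqr_ge0.
Qed.

(** The orbit starts below the fixed point [(1 - p)^-1] of a nondecreasing map and stays there. *)
Lemma affine_iter_lt1 (R : realType) (p : R) n : 0 <= p -> p < 1 ->
  iter n (fun x => p * x + 1) 1 <= (1 - p)^-1.
Proof.
move=> p0 p1; have q0 : 0 < 1 - p by rewrite subr_gt0.
have fixp : p * (1 - p)^-1 + 1 = (1 - p)^-1 by field; rewrite gt_eqF.
elim: n => [|n IHn] /=; first by rewrite -fixp lerDr mulr_ge0// invr_ge0 ltW.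
by rewrite -[leRHS]fixp lerD2r ler_wpM2l.
Qed.

Lemma affine_iter1 (R : realType) n :
  iter n (fun x : R => 1 * x + 1) 1 = n.+1%:R.
Proof. by elim: n => //= n ->; rewrite mul1r natr1. Qed.

Lemma affine_iter_gt1 (R : realType) (p : R) n : 1 < p ->
  iter n (fun x => p * x + 1) 1 <= p / (p - 1) * p ^+ n.
Proof.
move=> p1; have nz : p - 1 != 0 by rewrite subr_eq0 gt_eqF.
suff -> : iter n (fun x => p * x + 1) 1 =
    p / (p - 1) * p ^+ n - (p - 1)^-1.
  by rewrite gerDl oppr_le0 invr_ge0 subr_ge0 ltW.
elim: n => [|n /= ->]; first by rewrite expr0 /=; field.
by rewrite exprS; field.
Qed.

(** * Lower bounds for arbitrary solutions *)

(** Kept free of division so that d may begin with several zeros; no index shift here. *)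
Definition rescaled (R : realType) (q : R) (d : nat -> R) : Prop :=
  d 0%N = 0 /\ forall n, d n.+1 * d n.+2 = q * d n ^+ 2 + d n.+1.

(** If m+1 is the first nonzero index, d_{m+1} d_{m+2} = d_{m+1} forces d_{m+2} = 1; from there d_k
    d_{k+1} >= d_k propagates the bound. *)
Lemma rescaled_ge1 (R : realType) (q : R) (d : nat -> R) :
  0 <= q -> rescaled q d -> (exists n, d n != 0) ->
  exists N, forall n, (N <= n)%N -> 1 <= d n.
Proof.
move=> q0 [d0 rec] /ex_minnP[[|m] dm minm]; first by rewrite d0 eqxx in dm.
have dm0 : d m = 0.
  by apply/eqP/negP => /negP /minm; rewrite ltnn.
exists m.+2 => n /subnK <-; elim: (n - m.+2)%N => [|k IHk].
  suff -> : d m.+2 = 1 by [].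
  by apply: (mulfI dm); rewrite rec dm0 expr0n/= mulr0 add0r mulr1.
have dk0 : 0 < d (k + m.+2)%N by lra.
by rewrite -(ler_pM2l dk0) mulr1 addSn !addnS rec lerDr mulr_ge0 ?sqr_ge0.
Qed.

Lemma energy_rec (R : realType) (q : R) (d : nat -> R) n : rescaled q d ->
  d n.+2 * d n.+1 ^+ 2 = q * (d n.+1 * d n ^+ 2) + d n.+1 ^+ 2.
Proof. by move=> [_ rec]; rewrite expr2 mulrA (mulrC (d n.+2)) rec; ring. Qed.

(** For q = 1 the energy gains d_{n+1}^2 >= 1 at each step, whereas d < M would keep it below
    M^3. *)
Lemma rescaled1_unbounded (R : realType) (d : nat -> R) (M : R) N :
  rescaled 1 d -> (exists n, d n != 0) -> exists2 n, (N <= n)%N & M <= d n.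
Proof.
move=> resc /(rescaled_ge1 ler01 resc)[N0 d_ge1].
apply: contrapT => noM.
have dM n : (N <= n)%N -> d n < M.
  by move=> Nn; rewrite ltNge; apply/negP => Mn; apply: noM; exists n.
pose K := maxn N N0.
have E_ge k : k%:R <= d (k + K).+1 * d (k + K)%N ^+ 2.
  elim: k => [|k IHk].
    by rewrite mulr_ge0 ?sqr_ge0// (le_trans ler01)// d_ge1; lia.
  rewrite addSn (energy_rec _ resc) mul1r -natr1 lerD//.
  by rewrite exprn_ege1// d_ge1; lia.
have [k kM] : exists k : nat, M ^+ 3 < k%:R.
  exists (Num.bound `|M ^+ 3|).
  exact: le_lt_trans (ler_norm _) (archi_boundP (normr_ge0 _)).
have := E_ge k; apply/negP; rewrite -ltNge; apply: lt_trans kM.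
have d1 : 1 <= d (k + K).+1 by apply: d_ge1; lia.
have d2 : 1 <= d (k + K)%N by apply: d_ge1; lia.
have M1 : d (k + K).+1 < M by apply: dM; lia.
have M2 : d (k + K)%N < M by apply: dM; lia.
rewrite (exprS M) ltr_pM ?sqr_ge0//; first lra.
by rewrite ltr_pXn2r ?nnegrE//; lra.
Qed.

Lemma rescaled_cube_growth (R : realType) (p : R) (d : nat -> R) :
  1 < p -> rescaled (p ^+ 3) d -> (exists n, d n != 0) ->
  exists2 c : R, 0 < c &
    forall N, exists2 n, (N <= n)%N & c * p ^+ n <= d n.
Proof.
move=> p1 resc dn0.
have p0 : 0 < p by lra.
have [N0 d_ge1] := rescaled_ge1 (exprn_ge0 3 (ltW p0)) resc dn0.
(* The energy at k + N0 is at least p^(3k), so one of its factors reaches p^k. The exponent N0 + 1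
   absorbs the offset N0 and the later index of the factor d_{n+1}. *)
exists (p ^- N0.+1); first by rewrite invr_gt0 exprn_gt0.
move=> N; apply: contrapT => small.
have d_lt n : (N <= n)%N -> d n < p ^- N0.+1 * p ^+ n.
  by move=> Nn; rewrite ltNge; apply/negP => ?; apply: small; exists n.
have E_ge k : (p ^+ k) ^+ 3 <= d (k + N0).+1 * d (k + N0)%N ^+ 2.
  elim: k => [|k IHk].
    by rewrite expr0 expr1n mulr_ege1 ?exprn_ege1 ?d_ge1.
  rewrite addSn (energy_rec _ resc) (exprS p k) exprMn.
  by rewrite ler_wpDr ?sqr_ge0// ler_wpM2l// exprn_ge0// ltW.
have := E_ge N; apply/negP; rewrite -ltNge.
have P0 : 0 < p ^+ N by rewrite exprn_gt0.
have d1 : 1 <= d (N + N0).+1 by apply: d_ge1; lia.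
have d2 : 1 <= d (N + N0)%N by apply: d_ge1; lia.
have pN : p ^+ N = p ^- N0.+1 * p ^+ (N + N0).+1.
  by rewrite -addnS exprD mulrCA mulVf ?mulr1// expf_neq0// gt_eqF.
have lt1 : d (N + N0).+1 < p ^+ N by rewrite pN; apply: d_lt; lia.
have lt2 : d (N + N0)%N < p ^+ N.
  rewrite pN; apply: lt_le_trans (d_lt _ _) _; first lia.
  by rewrite ler_wpM2l ?invr_ge0 ?exprn_ge0 ?ler_weXn2l// ltW.
rewrite (exprS (p ^+ N)) ltr_pM ?sqr_ge0//; first lra.
by rewrite ltr_pXn2r ?nnegrE//; lra.
Qed.

(** * Change of variables and construction of a solution *)

(** Writing A_n for this factor, lambda^(beta (n+1)) A_{n+1} = lambda^(2n), which equalises the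
    linear and bilinear coefficients of the equation. *)
Definition amplitude (R : realType) (lambda beta : R) (n : nat) : R :=
  lambda `^ ((2 - beta) * n%:R - 2).

Lemma powR_add (R : realType) (x r s : R) : 0 < x ->
  x `^ r * x `^ s = x `^ (r + s).
Proof. by move=> x0; rewrite powRD// (gt_eqF x0) implybT. Qed.

Lemma powR_gt1 (R : realType) (x r : R) : 1 < x -> 0 < r -> 1 < x `^ r.
Proof.
move=> x1 r0; rewrite /powR gt_eqF ?(lt_trans ltr01)// -expR0 ltr_expR.
by rewrite mulr_gt0 ?ln_gt0.
Qed.

Lemma stationary_rescaled (R : realType) (lambda beta : R) (d : nat -> R) :
  1 < lambda ->
  stationary_solution lambda beta (fun n => - amplitude lambda beta n * d n) <->
  rescaled (lambda `^ (2 * (beta - 3))) d.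
Proof.
move=> l1; have l0 : 0 < lambda by lra.
have powN (n : nat) : lambda ^+ n = lambda `^ n%:R by rewrite powR_mulrn ?ltW.
have main n : lambda ^+ (2 * n.+1) * (- amplitude lambda beta n.+1 * d n.+1)
    - lambda `^ (beta * n.+1%:R) * (- amplitude lambda beta n * d n) ^+ 2
    + lambda `^ (beta * n.+2%:R) * (- amplitude lambda beta n.+1 * d n.+1)
      * (- amplitude lambda beta n.+2 * d n.+2) =
    lambda `^ ((4 - beta) * n.+1%:R - 2) *
    (d n.+1 * d n.+2 - (lambda `^ (2 * (beta - 3)) * d n ^+ 2 + d n.+1)).
  have t1 : lambda ^+ (2 * n.+1) * amplitude lambda beta n.+1 =
      lambda `^ ((4 - beta) * n.+1%:R - 2).
    by rewrite powN /amplitude powR_add// natrM; congr (_ `^ _); ring.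
  have t2 : lambda `^ (beta * n.+1%:R) * amplitude lambda beta n ^+ 2 =
      lambda `^ ((4 - beta) * n.+1%:R - 2) * lambda `^ (2 * (beta - 3)).
    rewrite expr2 /amplitude !powR_add// -(natr1 n); congr (_ `^ _); ring.
  have t3 : lambda `^ (beta * n.+2%:R) * amplitude lambda beta n.+1 *
      amplitude lambda beta n.+2 = lambda `^ ((4 - beta) * n.+1%:R - 2).
    by rewrite /amplitude !powR_add// -(natr1 n.+1); congr (_ `^ _); ring.
  transitivity (- (lambda ^+ (2 * n.+1) * amplitude lambda beta n.+1) * d n.+1
    - (lambda `^ (beta * n.+1%:R) * amplitude lambda beta n ^+ 2) * d n ^+ 2
    + (lambda `^ (beta * n.+2%:R) * amplitude lambda beta n.+1 *
       amplitude lambda beta n.+2) * (d n.+1 * d n.+2)); first by ring.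
  by rewrite t1 t2 t3; ring.
have amp0 n : 0 < amplitude lambda beta n by rewrite powR_gt0.
split=> [[a0 H]|[d0 H]]; split.
- by move/eqP: a0; rewrite mulf_eq0 oppr_eq0 gt_eqF//= => /eqP.
- move=> n; have := H n.+1 isT; rewrite main => /eqP.
  by rewrite mulf_eq0 gt_eqF ?powR_gt0//= subr_eq0 => /eqP.
- by rewrite d0 mulr0.
- by move=> [//|n] _; rewrite main H subrr mulr0.
Qed.

(** [d 2 = 1] is recorded as a witness of nontriviality, since d_1 = s is only known to be
    nonnegative. *)
Lemma rescaled_exists (R : realType) (p : R) : 0 <= p -> exists d : nat -> R,
  [/\ rescaled (p ^+ 3) d, d 2%N = 1 &
      forall n, 0 <= d n.+1 <= iter n (fun x => p * x + 1) 1].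
Proof.
move=> p0; have q0 : 0 <= p ^+ 3 by rewrite exprn_ge0.
have [s [s0 s1 mono]] := increasing_profile q0.
exists (fun n => if n is m.+1 then profile (p ^+ 3) s m else 0); split=> //.
  split=> // -[|n]; first by rewrite expr0n/= mulr0 add0r mulr1.
  exact: profile_rec.
move=> n; rewrite profile_ge0//=; apply: increasing_growth => // k.
exact: profile_rec.
Qed.

Theorem theorem0p10 (R : realType) (lambda beta : R)
    (lambda_gt1 : 1 < lambda) (beta_gt0 : 0 < beta) :
  (exists a : nat -> R,
    [/\ stationary_solution lambda beta a, nontrivial a &
      [/\ beta < 3 ->
            a =O_\oo (fun n : nat => lambda `^ ((2 - beta) * n%:R)),
          beta = 3 ->
            a =O_\oo (fun n : nat => n%:R * lambda ^- n) &
          3 < beta ->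
            a =O_\oo (fun n : nat => lambda `^ (- beta * n%:R / 3))]]) /\
  (forall a : nat -> R, stationary_solution lambda beta a -> nontrivial a ->
    [/\ beta < 3 ->
          (0 < limn_esup
             (fun n : nat => (`|a n| * lambda `^ ((beta - 2) * n%:R))%:E))%E,
        beta = 3 ->
          limn_esup (fun n : nat => (`|a n| * lambda ^+ n)%:E) = +oo%E &
        3 < beta ->
          (0 < limn_esup
             (fun n : nat => (`|a n| * lambda `^ (beta * n%:R / 3))%:E))%E]).
Proof.
have l0 : 0 < lambda by lra.
have amp0 n : 0 < amplitude lambda beta n by rewrite powR_gt0.
(* p is the cube root of q; its position relative to 1 separates the three regimes. *)
pose p := lambda `^ (2 * (beta - 3) / 3).
have p0 : 0 < p by rewrite powR_gt0.
have p3 : lambda `^ (2 * (beta - 3)) = p ^+ 3.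
  by rewrite -powR_mulrn ?ltW// -powRrM; congr (_ `^ _); field.
have pn n : p ^+ n = lambda `^ (2 * (beta - 3) / 3 * n%:R).
  by rewrite powRrM powR_mulrn// ltW.
have p_lt1 : beta < 3 -> p < 1.
  move=> b3; rewrite /p -[X in _ `^ X]opprK powRN invf_lt1 ?powR_gt0//.
  by apply: powR_gt1 => //; lra.
have p_eq1 : beta = 3 -> p = 1.
  by move=> b3; rewrite /p b3 subrr mulr0 mul0r powRr0.
have p_gt1 : 3 < beta -> 1 < p.
  by move=> b3; apply: powR_gt1 => //; lra.
have ampE n : amplitude lambda beta n = lambda ^- 2 * lambda `^ ((2 - beta) * n%:R).
  by rewrite /amplitude -powR_invn ?(ltW l0)// powR_add// addrC.
have amp_p n : lambda `^ ((2 - beta) * n%:R) * p ^+ n =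
    lambda `^ (- beta * n%:R / 3).
  by rewrite pn powR_add//; congr (_ `^ _); field.
split.
  have [d [resc d2 bound]] := rescaled_exists (ltW p0).
  exists (fun n => - amplitude lambda beta n * d n); split.
  - by apply/stationary_rescaled => //; rewrite p3.
  - by exists 2%N; rewrite d2 mulr1 oppr_eq0 gt_eqF.
  (* The bound on d starts at index 1, so the O-estimate is claimed from there on. *)
  have big (C : R) (g : nat -> R) : 0 <= C ->
      (forall n, amplitude lambda beta n.+1 *
         iter n (fun x => p * x + 1) 1 <= C * g n.+1) ->
      (fun n => - amplitude lambda beta n * d n) =O_\oo g.
    move=> C0 Cg; apply/eqOP; exists C; split; first exact: ger0_real.
    move=> K CK; exists 1%N => // -[//|n] _ /=.
    have /andP[dn0 dnG] := bound n.
    rewrite mulNr normrN ger0_norm ?mulr_ge0 ?(ltW (amp0 _))//.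
    apply: le_trans (_ : C * g n.+1 <= _).
      by apply: le_trans (Cg n); rewrite ler_pM2l.
    apply: le_trans (_ : C * `|g n.+1| <= _).
      by rewrite ler_wpM2l ?ler_norm.
    by rewrite ler_wpM2r// ltW.
  split=> b3.
  - have p1 := p_lt1 b3.
    apply: (big (lambda ^- 2 * (1 - p)^-1)) => [|n].
      by rewrite mulr_ge0 ?invr_ge0 ?exprn_ge0 ?subr_ge0 ?ltW.
    rewrite ampE -!mulrA ler_pM2l ?invr_gt0 ?exprn_gt0//.
    rewrite mulrC ler_wpM2r ?powR_ge0//.
    exact: affine_iter_lt1 (ltW p0) p1.
  - apply: (big (lambda ^- 2)) => [|n]; first by rewrite invr_ge0 exprn_ge0 ?ltW.
    rewrite (p_eq1 b3) affine_iter1 ampE -mulrA (mulrC n.+1%:R).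
    rewrite -(powR_invn n.+1 (ltW l0)) b3.
    by rewrite (_ : (2 - 3) * n.+1%:R = - n.+1%:R :> R)//; ring.
  - have p1 := p_gt1 b3.
    apply: (big (lambda ^- 2 * (p - 1)^-1)) => [|n].
      by rewrite mulr_ge0 ?invr_ge0 ?exprn_ge0 ?subr_ge0 ?ltW.
    rewrite ampE -amp_p -!mulrA ler_pM2l ?invr_gt0 ?exprn_gt0//.
    rewrite mulrCA ler_pM2l ?powR_gt0//.
    by apply: le_trans (affine_iter_gt1 n p1) _; rewrite exprS mulrA (mulrC p).
move=> a sol [m [_ am]].
pose d n := - a n / amplitude lambda beta n.
have ad n : a n = - amplitude lambda beta n * d n.
  by rewrite /d; field; rewrite gt_eqF.
have resc : rescaled (p ^+ 3) d.
  rewrite -p3; apply/stationary_rescaled => //.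
  by rewrite (_ : (fun n => _) = a)//; apply/funext => n; rewrite ad.
have dn0 : exists n, d n != 0.
  by exists m; rewrite /d mulf_neq0 ?oppr_eq0// invr_eq0 gt_eqF.
(* x is the exponent of the weight and y what remains after cancelling the amplitude: y = 0 for beta
   <= 3, and lambda^y = p^(-n) for beta > 3. *)
have normE n x y : (2 - beta) * n%:R + x = y ->
    `|a n| * lambda `^ x = lambda ^- 2 * lambda `^ y * `|d n|.
  move=> <-; rewrite ad mulNr normrN normrM (gtr0_norm (amp0 _)) ampE.
  by rewrite -powR_add//; ring.
have l2 : 0 < lambda ^- 2 by rewrite invr_gt0 exprn_gt0.
split=> b3.
- have [N d_ge1] := rescaled_ge1 (exprn_ge0 3 (ltW p0)) resc dn0.
  apply: (@lt_le_trans _ _ (lambda ^- 2)%:E); first by rewrite lte_fin.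
  apply: frequently_le_limn_esup => k; exists (maxn k N); first exact: leq_maxl.
  rewrite lee_fin (normE _ _ 0); last by ring.
  rewrite powRr0 mulr1 ler_pMr//.
  by apply: le_trans (ler_norm _); apply: d_ge1; exact: leq_maxr.
- rewrite (p_eq1 b3) expr1n in resc.
  apply/eqyP => A A0; apply: frequently_le_limn_esup => N.
  (* The factor lambda^2 offsets the lambda^(-2) of the amplitude. *)
  have [n Nn dn] := rescaled1_unbounded (A * lambda ^+ 2) N resc dn0.
  exists n => //; rewrite lee_fin -powR_mulrn ?(ltW l0)// (normE _ _ 0).
    rewrite powRr0 mulr1 mulrC ler_pdivlMr ?exprn_gt0//.
    exact: le_trans dn (ler_norm _).
  by rewrite b3; ring.
- have [c c0 freq] := rescaled_cube_growth (p_gt1 b3) resc dn0.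
  apply: (@lt_le_trans _ _ (lambda ^- 2 * c)%:E).
    by rewrite lte_fin mulr_gt0.
  apply: frequently_le_limn_esup => N; have [n Nn dn] := freq N.
  exists n => //; rewrite lee_fin (normE _ _ (- (2 * (beta - 3) / 3 * n%:R))).
    rewrite powRN -pn -mulrA ler_pM2l// mulrC ler_pdivlMr ?exprn_gt0//.
    exact: le_trans dn (ler_norm _).
  by field.
Qed.
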